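(* Let $n\in\mathbb{N}$ and let $\mathcal{M}\subseteq\Delta_n$ be a one-dimensional discrete model of maximum likelihood degree one, represented by $(c_i,\nu_i,\mu_i)_{i=0}^n$. Then $$\deg(\mathcal{M})=\max\{\nu_i+\mu_i \mid i\in\{0,\ldots,n\}\}\le 2n-1.$$
   Context: $\Delta_n=\{p\in\mathbb{R}^{n+1}\mid p_0+\ldots+p_n=1,\ p_i\ge 0 \text{ for all } i\}$ is the probability simplex, and $\mathbb{N}$ includes $0$. One-dimensional discrete models of maximum likelihood degree one (also called rational one-dimensional models, R1d models) are, by a known classification that is taken here as the working definition, the models that are the image of a non-constant map $$p:[0,1]\to\Delta_n,\qquad t\mapsto (c_i t^{\nu_i}(1-t)^{\mu_i})_{i=0}^n,$$ with exponents $\nu_i,\mu_i\in\mathbb{N}$ and real coefficients (scalings) $c_i>0$; in particular $\sum_{i=0}^n c_i t^{\nu_i}(1-t)^{\mu_i}=1$ identically in $t$. The model is said to be represented by $(c_i,\nu_i,\mu_i)_{i=0}^n$. (The map being non-constant means that not all pairs $(\nu_i,\mu_i)$ equal $(0,0)$; the pairs need not be distinct.) The degree of the model is $\deg(\mathcal{M})=\max\{\nu_i+\mu_i\mid i\in\{0,\ldots,n\}\}$. *)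

(* Defs.v *)
From mathcomp Require Import all_boot all_order all_algebra.
From mathcomp Require Import boolp classical_sets set_interval reals.

Set Implicit Arguments.
Unset Strict Implicit.
Unset Printing Implicit Defensive.

Import Order.TTheory GRing.Theory Num.Theory.
Local Open Scope classical_set_scope.
Local Open Scope ring_scope.

Definition prob_simplex (R : realType) (n : nat) : set 'rV[R]_n.+1 :=
  [set p | \sum_(i < n.+1) p 0 i = 1 /\ forall i, 0 <= p 0 i].

(* Exponents are natural numbers, so a zero exponent contributes the factor 1
   also at the endpoints t = 0 and t = 1. *)
Definition R1d_map (R : realType) (n : nat) (c : 'I_n.+1 -> R)
    (nu mu : 'I_n.+1 -> nat) (t : R) : 'rV[R]_n.+1 :=
  \row_i (c i * t ^+ nu i * (1 - t) ^+ mu i).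

(* By a known classification, the one-dimensional discrete models of maximum
   likelihood degree one are exactly the sets M admitting such a representation
   (rational one-dimensional models); this is taken as their definition. *)
Definition R1d_represented (R : realType) (n : nat) (M : set 'rV[R]_n.+1)
    (c : 'I_n.+1 -> R) (nu mu : 'I_n.+1 -> nat) : Prop :=
  [/\ forall i, 0 < c i,
      forall t, t \in `[0, 1] -> prob_simplex (R1d_map c nu mu t),
      exists s t, [/\ s \in `[0, 1], t \in `[0, 1]
                    & R1d_map c nu mu s <> R1d_map c nu mu t]
    & M = R1d_map c nu mu @` `[0, 1]%classic].

Definition R1d_degree (n : nat) (nu mu : 'I_n.+1 -> nat) : nat :=
  \max_(i < n.+1) (nu i + mu i)%N.

(* Main.v *)
(* Write d_i = nu_i + mu_i and substitute t = -x / (1 - x).  The polynomials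
     Q_k = (1-x)^k - sum_(d_i <= k) c_i (-x)^nu_i (1-x)^(k-d_i)
   satisfy Q_(k+1) = (1-x) Q_k - sum_(d_i = k+1) c_i (-x)^nu_i, and positivity
   of the c_i gives Q_k <> 0 for k < d while Q_d = 0, d being the degree.
   Multiplication by 1-x creates at least one more sign change in the coefficient
   sequence, and altering one coefficient destroys at most two.  Hence, if h
   terms have d_i = d, then (1-x) Q_(d-1) has at least d - 2(n+1-h) sign changes;
   being a sum of h monomials, it has at most h-1 of them.  As (1-x) Q_(d-1) is not
   a monomial, h >= 2, so d <= 2(n+1) - h - 1 <= 2n - 1. *)
Require Import Defs.
From mathcomp Require Import all_boot all_order all_algebra.
From mathcomp Require Import boolp classical_sets set_interval reals.
From mathcomp Require Import zify ring lra.

Set Implicit Arguments.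
Unset Strict Implicit.
Unset Printing Implicit Defensive.

Import Order.TTheory GRing.Theory Num.Theory.
Local Open Scope classical_set_scope.
Local Open Scope ring_scope.

(** * Sign alternations in coefficient sequences *)

(* [alternates p m e b]: there are indices b > i_1 > ... > i_m at which the
   coefficients of p are nonzero with alternating signs, the one at i_1 having
   the sign of e. *)
Fixpoint alternates (R : realDomainType) (p : {poly R}) (m : nat) (e : R)
    (b : nat) : Prop :=
  if m is m'.+1 then
    exists i, [/\ (i < b)%N, 0 < e * p`_i & alternates p m' (- e) i]
  else True.

Lemma alternates_le (R : realDomainType) (p : {poly R}) m e b b' :
  (b <= b')%N -> alternates p m e b -> alternates p m e b'.
Proof.
by case: m => [//|m] le_bb' [i [lt_ib pos alt_p]]; exists i; split=> //; lia.
Qed.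

Lemma eq_alternates (R : realDomainType) (p q : {poly R}) m e b :
  (forall i, (i < b)%N -> p`_i = q`_i) -> alternates p m e b ->
  alternates q m e b.
Proof.
elim: m e b => [//|m IHm] e b eq_pq [i [lt_ib pos alt_p]].
exists i; split=> //; first by rewrite -eq_pq.
by apply: IHm alt_p => j lt_ji; apply: eq_pq; lia.
Qed.

Lemma alternates_neq0 (R : realDomainType) (p : {poly R}) :
  p != 0 -> exists e b, alternates p 1 e b.
Proof.
move=> p_neq0; exists (lead_coef p), (size p), (size p).-1; split=> //.
  by rewrite prednK // size_poly_gt0.
by rewrite -/(lead_coef p) -expr2 exprn_even_gt0 // lead_coef_eq0.
Qed.

Lemma exists_increase (R : realDomainType) (g : nat -> R) i k :
  (i <= k)%N -> g i < g k -> exists j, (i <= j < k)%N /\ g j < g j.+1.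
Proof.
elim: k => [|k IHk] le_ik lt_g; first by move: le_ik lt_g; case: i; rewrite ?ltxx.
have [eq_ik|neq_ik] := eqVneq i k.+1; first by rewrite eq_ik ltxx in lt_g.
have [lt_k|le_k] := ltP (g k) (g k.+1); first by exists k; split=> //; lia.
have [||j [/andP[le_ij lt_jk] lt_gj]] := IHk; first by lia.
  exact: lt_le_trans lt_g le_k.
by exists j; split=> //; lia.
Qed.

(* The coefficients of p are the partial sums of those of (1 - X) p. *)
Lemma coef_mul1BX_gt0 (R : realDomainType) (p : {poly R}) e i k :
  (i <= k)%N -> e * (p * 'X)`_i < e * (p * 'X)`_k ->
  exists j, (i <= j < k)%N /\ 0 < e * ((1 - 'X) * p)`_j.
Proof.
move=> le_ik /(@exists_increase _ (fun j => e * (p * 'X)`_j) _ _ le_ik).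
move=> [j [jP lt_j]]; exists j; split=> //; move: lt_j.
rewrite [(p * 'X)`_j.+1]coefMX /= mulrBl mul1r coefB.
by rewrite ['X * p]mulrC mulrBr subr_gt0.
Qed.

(** Between consecutive chain indices i' < i, the coefficients of [e *: p] rise from negative to
    positive, so a difference in the range i'+1, ..., i is positive. At the bottom of the chain the
    rise starts from 0, the value before index 0. *)
Lemma alternates_mul1BX_le (R : realDomainType) (p : {poly R}) m e i :
  0 < e * p`_i -> alternates p m (- e) i ->
  exists j, [/\ (j <= i)%N, 0 < e * ((1 - 'X) * p)`_j
              & alternates ((1 - 'X) * p) m (- e) j].
Proof.
elim: m e i => [|m IHm] e i pos /=.
  have [//||j [/andP[_ lt_ji] pos_j] _] := @coef_mul1BX_gt0 _ p e 0 i.+1.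
    by rewrite !coefMX /= mulr0.
  by exists j.
move=> [i' [lt_i'i pos' alt_p]].
have [j' [le_j' pos_j' alt_j']] := IHm _ _ pos' alt_p.
have [||j [/andP[le_j lt_j] pos_j]] := @coef_mul1BX_gt0 _ p e i'.+1 i.+1.
- by lia.
- by rewrite !coefMX /=; move: pos'; rewrite mulNr; lra.
by exists j; split=> //; exists j'; split=> //; lia.
Qed.

(** The extra sign change sits on top: past [size p] the coefficients are 0, so they must fall back
    from the top entry of the chain. *)
Lemma alternates_mul1BX (R : realDomainType) (p : {poly R}) m e b :
  alternates p m.+1 e b ->
  exists e' b', alternates ((1 - 'X) * p) m.+2 e' b'.
Proof.
move=> [i [_ pos alt_p]]; set k := (maxn i (size p)).+1.
have [j' [le_j' pos_j' alt_j']] := alternates_mul1BX_le pos alt_p.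
have [||j [/andP[le_j lt_j] pos_j]] := @coef_mul1BX_gt0 _ p (- e) i.+1 k.
- by rewrite /k; lia.
- rewrite !coefMX /= [X in _ < _ * X]nth_default ?leq_maxr // mulr0 mulNr.
  by rewrite oppr_lt0.
exists (- e), k, j; split=> //; exists j'; rewrite opprK; split=> //; lia.
Qed.

(* Delete the altered index from the chain, together with the index below it. *)
Lemma alternates_change_coef (R : realDomainType) (p q : {poly R}) x m e b :
  (forall i, i != x -> p`_i = q`_i) -> alternates p m.+2 e b ->
  alternates q m e b.
Proof.
move=> eq_pq; elim: m e b => [//|m IHm] e b [i [lt_ib pos alt_p]].
have [eq_ix|neq_ix] := eqVneq i x; last first.
  by exists i; split=> //; [rewrite -eq_pq | exact: IHm].
case: alt_p => i' [lt_i'i _]; rewrite opprK => alt_p.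
apply: (@alternates_le _ _ _ _ i'); first by lia.
by apply: (@eq_alternates _ p q m.+1 e i') alt_p => j lt_ji'; apply: eq_pq; lia.
Qed.

Lemma alternates_sub_monomials (R : realDomainType) (I : Type) (r : seq I)
    (P : pred I) (a : I -> R) (nu : I -> nat) (p : {poly R}) m e b :
  alternates p (m + 2 * count P r) e b ->
  alternates (p - \sum_(i <- r | P i) a i *: 'X^(nu i)) m e b.
Proof.
elim: r p => [|i r IHr] p /=; first by rewrite big_nil subr0 muln0 addn0.
rewrite big_cons; case: (P i) => /=; last exact: IHr.
rewrite opprD addrA => alt_p; apply: IHr.
apply: (@alternates_change_coef _ p _ (nu i)).
  by move=> j neq_j; rewrite coefB coefZ coefXn (negPf neq_j) mulr0 subr0.
by move: alt_p; rewrite mulnDr addnCA.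
Qed.

(** Counting only the entries of [s] below [b] makes the induction work: the rest of the chain lies
    below [i], and [i] itself adds one. *)
Lemma alternates_size (R : realDomainType) (p : {poly R}) (s : seq nat) m e b :
  (forall i, p`_i != 0 -> i \in s) -> alternates p m e b ->
  (m <= count (fun i => (i < b)%N) s)%N.
Proof.
move=> supp_p; elim: m e b => [//|m IHm] e b [i [lt_ib pos /IHm le_m]].
have i_s : i \in s.
  by apply: supp_p; apply: contraTneq pos => ->; rewrite mulr0 ltxx.
apply: (@leq_ltn_trans (count (fun j => (j < i)%N) s)) => //.
elim: s i_s {IHm supp_p le_m} => [//|j s IHs] /=.
have le_count : (count (fun j => (j < i)%N) s <= count (fun j => (j < b)%N) s)%N.
  by apply: sub_count => k /=; lia.
rewrite inE => /predU1P[<-|/IHs]; first by rewrite ltnn lt_ib; lia.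
by case: (ltnP j i); case: (ltnP j b) => /=; lia.
Qed.

Lemma alternates_sum_monomials (R : realDomainType) (I : Type) (r : seq I)
    (P : pred I) (a : I -> R) (nu : I -> nat) m e b :
  alternates (\sum_(i <- r | P i) a i *: 'X^(nu i)) m e b ->
  (m <= count P r)%N.
Proof.
move=> /(@alternates_size _ _ [seq nu i | i <- r & P i])-/(_ _)/leq_trans; apply.
  move=> j; elim: r => [|i r IHr] /=; first by rewrite big_nil coef0 eqxx.
  rewrite big_cons; case: (P i) => //=.
  rewrite coefD coefZ coefXn inE; have [//|_] := eqVneq j (nu i).
  by rewrite mulr0 add0r.
by rewrite (leq_trans (count_size _ _)) // size_map size_filter.
Qed.

(** * The polynomials Q_k *)

Lemma poly_eq0_of_npos_roots (R : realDomainType) (p : {poly R}) :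
  (forall x, x <= 0 -> p.[x] = 0) -> p = 0.
Proof.
move=> p_root; apply: (@roots_geq_poly_eq0 _ _ [seq - i%:R | i <- iota 0 (size p)]).
- by apply/allP => _ /mapP[i _ ->]; rewrite /root p_root // oppr_le0.
- by rewrite map_inj_uniq ?iota_uniq // => i j /oppr_inj/eqP; rewrite eqr_nat => /eqP.
- by rewrite size_map size_iota.
Qed.

(** This is Q_k; the range of summation keeps the natural subtraction exact. *)
Definition residual (R : realFieldType) (I : finType) (c : I -> R)
    (nu mu : I -> nat) (k : nat) : {poly R} :=
  (1 - 'X) ^+ k - \sum_(i | (nu i + mu i <= k)%N)
    c i *: ((- 'X) ^+ nu i * (1 - 'X) ^+ (k - (nu i + mu i))).

(** Old terms gain a factor 1 - X; the new ones, of degree k+1, carry no power of 1 - X and so are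
    monomials. *)
Lemma residualS (R : realFieldType) (I : finType) (c : I -> R)
    (nu mu : I -> nat) k :
  residual c nu mu k.+1 = (1 - 'X) * residual c nu mu k
    - \sum_(i | (nu i + mu i == k.+1)%N) ((-1) ^+ nu i * c i) *: 'X^(nu i).
Proof.
rewrite /residual mulrBr -exprS mulr_sumr.
rewrite (bigID (fun i => (nu i + mu i <= k)%N)) /= opprD addrA.
congr (_ - _ - _).
  apply: eq_big => [i|i /andP[_ le_k]]; first by lia.
  by rewrite subSn // exprS -scalerAr; congr (_ *: _); ring.
apply: eq_big => [i|i /andP[]]; first by lia.
rewrite -ltnNge => le1 le2; have -> : (k.+1 - (nu i + mu i) = 0)%N by lia.
rewrite mulr1 (exprNn 'X) [_ * c i]mulrC -scalerA.
by rewrite -signr_odd -[in RHS]signr_odd scaler_sign mulr_sign.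
Qed.

(** With t = -x / (1 - x) one has 1 - t = 1 / (1 - x), and x <= 0 puts t in [0, 1). *)
Lemma horner_residual (R : realFieldType) (I : finType) (c : I -> R)
    (nu mu : I -> nat) k (x : R) : x <= 0 ->
  (residual c nu mu k).[x] = (1 - x) ^+ k *
    (1 - \sum_(i | (nu i + mu i <= k)%N)
       c i * (- x / (1 - x)) ^+ nu i * (1 - - x / (1 - x)) ^+ mu i).
Proof.
move=> x_le0; have y_neq0 : 1 - x != 0 by apply: lt0r_neq0; lra.
rewrite /residual hornerD hornerN horner_exp hornerD hornerN hornerX hornerC.
rewrite horner_sum mulrBr mulr1 mulr_sumr.
congr (_ - _); apply: eq_bigr => i le_k.
rewrite hornerZ hornerM !horner_exp hornerD !hornerN hornerX hornerC.
have -> : 1 - - x / (1 - x) = (1 - x)^-1 by field.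
rewrite expr_div_n exprVn -[in RHS](subnKC le_k) !exprD.
by field; rewrite !expf_neq0.
Qed.

Lemma residual_neq0 (R : realFieldType) (I : finType) (c : I -> R)
    (nu mu : I -> nat) k :
  (forall i, 0 < c i) ->
  (forall t : R, 0 <= t <= 1 -> \sum_i c i * t ^+ nu i * (1 - t) ^+ mu i = 1) ->
  (exists i, k < nu i + mu i)%N -> residual c nu mu k != 0.
Proof.
move=> c_gt0 sum1 [i0 lt_k]; apply/eqP => /(congr1 (fun p => p.[-1])).
rewrite horner_residual ?lerN10 // horner0; apply/eqP.
(* The point x = -1 gives t = 1/2, where each omitted term is strictly positive. *)
set t : R := - -1 / (1 - -1); have tE : t = 2^-1 by rewrite /t; field.
have t_gt0 : 0 < t by rewrite tE invr_gt0.
have t1_gt0 : 0 < 1 - t by rewrite tE; lra.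
have t01 : 0 <= t <= 1 by apply/andP; split; lra.
rewrite mulf_neq0 ?expf_neq0 //; first by apply: lt0r_neq0; lra.
rewrite -[X in X - _](sum1 t t01).
rewrite (bigID (fun i => (nu i + mu i <= k)%N)) /= addrAC subrr add0r.
rewrite (bigD1 i0) /= -?ltnNge //; apply: lt0r_neq0.
by rewrite ltr_pwDl ?sumr_ge0 // => [|i _]; rewrite ?ltW // !mulr_gt0 ?exprn_gt0.
Qed.

Lemma residual_eq0 (R : realFieldType) (I : finType) (c : I -> R)
    (nu mu : I -> nat) k :
  (forall t : R, 0 <= t <= 1 -> \sum_i c i * t ^+ nu i * (1 - t) ^+ mu i = 1) ->
  (forall i, nu i + mu i <= k)%N -> residual c nu mu k = 0.
Proof.
move=> sum1 le_k; apply: poly_eq0_of_npos_roots => x x_le0; rewrite horner_residual //.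
rewrite (eq_bigl xpredT) => [|i]; last by rewrite le_k.
have y_gt0 : 0 < 1 - x by lra.
rewrite sum1 ?subrr ?mulr0 //; apply/andP; split.
  by rewrite divr_ge0 ?oppr_ge0 // ltW.
by rewrite ler_pdivrMr // mul1r; lra.
Qed.

(** A chain of length m+1 shows m sign changes. Each step gains one and loses at most two per
    monomial of degree k+1. *)
Lemma residual_alternates (R : realFieldType) (I : finType) (c : I -> R)
    (nu mu : I -> nat) d k :
  (forall k, (k < d)%N -> residual c nu mu k != 0) -> (k < d)%N ->
  exists m e b, alternates (residual c nu mu k) m.+1 e b /\
    (k <= m + 2 * count (fun i => nu i + mu i <= k)%N (index_enum I))%N.
Proof.
move=> res_neq0; elim: k => [|k IHk] lt_kd.
  have [e [b alt1]] := alternates_neq0 (res_neq0 _ lt_kd).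
  by exists 0%N, e, b.
have [m [e [b [/alternates_mul1BX[e' [b' alt_m]] le_k]]]] := IHk (ltnW lt_kd).
set h := count (fun i => nu i + mu i == k.+1)%N (index_enum I).
have count_k : (count (fun i => nu i + mu i <= k.+1) (index_enum I) =
    count (fun i => nu i + mu i <= k) (index_enum I) + h)%N.
  rewrite -count_predUI -[LHS]addn0; congr (_ + _)%N.
    by apply: eq_count => i /=; lia.
  apply/esym/eqP; rewrite -leqn0 leqNgt -has_count.
  by apply/hasPn => i _ /=; lia.
have [le_h|lt_h] := leqP (2 * h) m.+1.
  exists (m.+1 - 2 * h)%N, e', b'; split; last by rewrite count_k; lia.
  rewrite residualS; apply: alternates_sub_monomials.
  by rewrite -/h (_ : _ + _ = m.+2)%N //; lia.
(* Here the losses may use up the whole chain, but then twice the count alone exceeds k, and a chain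
   of length one suffices. *)
have [e1 [b1 alt1]] := alternates_neq0 (res_neq0 _ lt_kd).
by exists 0%N, e1, b1; split=> //; rewrite count_k; lia.
Qed.

Lemma degree_bound_monomials_sum1 (R : realFieldType) (I : finType) (c : I -> R)
    (nu mu : I -> nat) d :
  (forall i, 0 < c i) ->
  (forall t : R, 0 <= t <= 1 -> \sum_i c i * t ^+ nu i * (1 - t) ^+ mu i = 1) ->
  (forall i, nu i + mu i <= d.+1)%N -> (exists i, nu i + mu i = d.+1)%N ->
  (d.+1 + 3 <= 2 * #|I|)%N.
Proof.
move=> c_gt0 sum1 le_d [i0 eq_d].
have [k lt_k||m [e [b [/alternates_mul1BX[e' [b' alt_m]] le_dm]]]] :=
  @residual_alternates _ _ c nu mu d.+1 d; [|by []|].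
  by apply: residual_neq0 => //; exists i0; rewrite eq_d.
have := residualS c nu mu d; rewrite residual_eq0 // => /esym/eqP.
rewrite subr_eq0 => /eqP eq_res; move: alt_m; rewrite eq_res.
move=> /alternates_sum_monomials le_m.
have : (count (fun i => nu i + mu i <= d) (index_enum I) +
        count (fun i => nu i + mu i == d.+1) (index_enum I) = #|I|)%N.
  rewrite cardT enumT -[RHS](count_predC (fun i => nu i + mu i <= d)%N).
  by congr (_ + _)%N; apply: eq_count => i /=; have := le_d i; lia.
(* If h terms have top degree, then m + 2 <= h and d <= m + 2(#|I| - h), so d + h + 2 <= 2 #|I| with
   h >= 2. *)
by lia.
Qed.

Theorem theorem2p2 (R : realType) (n : nat) (M : set 'rV[R]_n.+1)
    (c : 'I_n.+1 -> R) (nu mu : 'I_n.+1 -> nat)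
    (hM : R1d_represented M c nu mu) :
  (R1d_degree nu mu)%:Z <= 2 * n%:Z - 1.
Proof.
case: hM => c_gt0 simplex [s [t [_ _ neq_st]] _].
have sum1 u : 0 <= u <= 1 -> \sum_i c i * u ^+ nu i * (1 - u) ^+ mu i = 1.
  move=> u01; have [sum_u _] : prob_simplex (R1d_map c nu mu u).
    by apply: simplex; rewrite in_itv.
  by rewrite -[RHS]sum_u; apply: eq_bigr => i _; rewrite mxE.
have le_deg i : (nu i + mu i <= R1d_degree nu mu)%N.
  exact: (@leq_bigmax_cond _ _ (fun i => nu i + mu i)%N).
have [i0 eq_deg] : exists i, (nu i + mu i = R1d_degree nu mu)%N.
  have [|i] := @bigop.eq_bigmax _ (fun i : 'I_n.+1 => nu i + mu i)%N.
    by rewrite card_ord.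
  by move=> eq_i; exists i; rewrite /R1d_degree eq_i.
case deg_eq : (R1d_degree nu mu) le_deg eq_deg => [|d] le_deg eq_deg.
  (* Degree 0 would make the map constant. *)
  case: neq_st; apply/rowP => i; rewrite !mxE.
  have := le_deg i; rewrite leqn0 addn_eq0 => /andP[/eqP-> /eqP->].
  by rewrite !expr0.
have := @degree_bound_monomials_sum1 _ _ c nu mu d c_gt0 sum1 le_deg.
by rewrite card_ord => /(_ (ex_intro _ i0 eq_deg)); lia.
Qed.
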